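(* (Soundness.) Let $\mathcal F\cup\{(\gamma;\,y)\}\subseteq\mathsf{Form}$ be a set of possibilistic formulas. If $\mathcal F\vdash(\gamma;\,y)$, then $\mathcal F\models(\gamma;\,y)$.
   Context: Let $V$ be a denumerable set of propositional variables and let $\mathcal L$ be the set of formulas generated inductively from $V$ by the binary connectives $\land,\lor,\to$ and the unary connectives $\neg,\circ$. An $\mathbf{mbCiw}$-valuation is a function $v:\mathcal L\to\{0,1\}$ such that for all $\alpha,\beta\in\mathcal L$: (1) $v(\alpha\land\beta)=1$ iff $v(\alpha)=1$ and $v(\beta)=1$; (2) $v(\alpha\lor\beta)=1$ iff $v(\alpha)=1$ or $v(\beta)=1$; (3) $v(\alpha\to\beta)=1$ iff $v(\alpha)=0$ or $v(\beta)=1$; (4) $v(\neg\alpha)=0$ implies $v(\alpha)=1$; (5) $v(\circ\alpha)=1$ iff $v(\alpha)=0$ or $v(\neg\alpha)=0$. Let $\mathsf{Val}$ be the set of all $\mathbf{mbCiw}$-valuations. Infima and suprema are taken in $[0,1]$, with the convention $\inf\emptyset=1$ and $\sup\emptyset=0$. A possibilistic formula is a pair $(\varphi;\,x)$ with $\varphi\in\mathcal L$ and $x\in(0,1]$; $\mathsf{Form}$ is the set of all possibilistic formulas. Semantics. A possibility distribution is any map $\pi:\mathsf{Val}\to[0,1]$. The necessity measure induced by $\pi$ is $N:\mathcal L\to[0,1]$, $N(\varphi)=\inf\{1-\pi(w)\mid w\in\mathsf{Val},\ w(\varphi)=0\}$. We write $\pi\models(\varphi;\,x)$ iff $N(\varphi)\ge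 x$; $\pi\models\mathcal F$ iff $\pi\models\Phi$ for all $\Phi\in\mathcal F$; and $\mathcal F\models\Phi$ iff every possibility distribution $\pi$ with $\pi\models\mathcal F$ satisfies $\pi\models\Phi$. Proof system. The axioms are all possibilistic formulas $(\chi;\,1)$ where $\chi$ is an instance (with $\alpha,\beta,\gamma\in\mathcal L$ arbitrary) of one of: (i) $\alpha\to(\beta\to\alpha)$; (ii) $(\alpha\to(\beta\to\gamma))\to((\alpha\to\beta)\to(\alpha\to\gamma))$; (iii) $\alpha\to(\beta\to(\alpha\land\beta))$; (iv) $(\alpha\land\beta)\to\alpha$; (v) $(\alpha\land\beta)\to\beta$; (vi) $\alpha\to(\alpha\lor\beta)$; (vii) $\beta\to(\alpha\lor\beta)$; (viii) $(\alpha\to\gamma)\to((\beta\to\gamma)\to((\alpha\lor\beta)\to\gamma))$; (ix) $(\alpha\to\beta)\lor\alpha$; (x) $\alpha\lor\neg\alpha$; (xi) $\circ\alpha\to(\alpha\to(\neg\alpha\to\beta))$; (xii) $\circ\alpha\lor(\alpha\land\neg\alpha)$. The inference rules are: [GMP] from $(\alpha;\,x)$ and $(\alpha\to\beta;\,y)$ infer $(\beta;\,\min\{x,y\})$; [S] from $(\alpha;\,x)$ infer $(\alpha;\,y)$ for any $y\in(0,1]$ with $y\le x$. A derivation of $\Phi$ from $\mathcal F$ is a finite sequence $(\Phi_1,\dots,\Phi_n)$ in $\mathsf{Form}$ with $\Phi_n=\Phi$, each $\Phi_i$ being an axiom instance, or an element of $\mathcal F$, or obtained from earlier elements of the sequence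 by GMP or S. We write $\mathcal F\vdash\Phi$ if there is a derivation of $\Phi$ from $\mathcal F$. *)

(* Defs.v *)
From HB Require Import structures.
From mathcomp Require Import all_boot all_order all_algebra.
From mathcomp Require Import mathcomp_extra boolp classical_sets cardinality.
From mathcomp Require Import reals interval_inference.

Set Implicit Arguments.
Unset Strict Implicit.
Unset Printing Implicit Defensive.

Import Order.TTheory GRing.Theory Num.Theory.

Local Open Scope classical_set_scope.
Local Open Scope ring_scope.

Definition denumerable (V : Type) : Prop := ([set: V] #= [set: nat])%card.

Inductive formula (V : Type) : Type :=
| Var of V
| And of formula V & formula V
| Or of formula V & formula V
| Imp of formula V & formula V
| Neg of formula V
| Circ of formula V.

Record is_mbCiw_valuation (V : Type) (v : formula V -> bool) : Prop := {
  val_and : forall a b, v (And a b) = true <-> v a = true /\ v b = true;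
  val_or : forall a b, v (Or a b) = true <-> v a = true \/ v b = true;
  val_imp : forall a b, v (Imp a b) = true <-> v a = false \/ v b = true;
  val_neg : forall a, v (Neg a) = false -> v a = true;
  val_circ : forall a, v (Circ a) = true <-> v a = false \/ v (Neg a) = false
}.

Record Val (V : Type) : Type := MkVal {
  val_fun :> formula V -> bool;
  val_funP : is_mbCiw_valuation val_fun
}.

Definition pformula (R : realType) (V : Type) : Type :=
  (formula V * {itv R & `]0, 1]})%type.

Definition possibility_distribution (R : realType) (V : Type) : Type :=
  Val V -> {i01 R}.

(* Infimum in the complete lattice [0, 1], for A included in [0, 1]; the
   library's [inf set0] is 0. *)
Definition inf01 (R : realType) (A : set R) : R :=
  if A == set0 then 1 else inf A.

Definition necessity (R : realType) (V : Type)
    (pi : possibility_distribution R V) (phi : formula V) : R :=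
  inf01 [set 1 - (pi w)%:num | w in [set w : Val V | w phi = false]].

Lemma necessity_itv (R : realType) (V : Type)
    (pi : possibility_distribution R V) (phi : formula V) :
  0 <= necessity pi phi <= 1.
Proof.
rewrite /necessity /inf01; case: eqP => [_|/eqP/set0P A0]; first by rewrite ler01 lexx.
set A := (X in inf X) in A0 *.
have lb0 : lbound A 0 by move=> _ [w _ <-]; rewrite subr_ge0.
apply/andP; split; first exact: lb_le_inf.
have [x Ax] := A0; apply: (@le_trans _ _ x); first by apply: ge_inf => //; exists 0.
by case: Ax => w _ <-; rewrite lerBlDr lerDl.
Qed.

Definition satisfies (R : realType) (V : Type)
    (pi : possibility_distribution R V) (Phi : pformula R V) : Prop :=
  Phi.2%:num <= necessity pi Phi.1.

Definition satisfies_set (R : realType) (V : Type)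
    (pi : possibility_distribution R V) (F : set (pformula R V)) : Prop :=
  forall Phi, F Phi -> satisfies pi Phi.

Definition entails (R : realType) (V : Type)
    (F : set (pformula R V)) (Phi : pformula R V) : Prop :=
  forall pi : possibility_distribution R V,
    satisfies_set pi F -> satisfies pi Phi.

Inductive mbCiw_axiom (V : Type) : formula V -> Prop :=
| Ax1 a b : mbCiw_axiom (Imp a (Imp b a))
| Ax2 a b c :
    mbCiw_axiom (Imp (Imp a (Imp b c)) (Imp (Imp a b) (Imp a c)))
| Ax3 a b : mbCiw_axiom (Imp a (Imp b (And a b)))
| Ax4 a b : mbCiw_axiom (Imp (And a b) a)
| Ax5 a b : mbCiw_axiom (Imp (And a b) b)
| Ax6 a b : mbCiw_axiom (Imp a (Or a b))
| Ax7 a b : mbCiw_axiom (Imp b (Or a b))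
| Ax8 a b c :
    mbCiw_axiom (Imp (Imp a c) (Imp (Imp b c) (Imp (Or a b) c)))
| Ax9 a b : mbCiw_axiom (Or (Imp a b) a)
| Ax10 a : mbCiw_axiom (Or a (Neg a))
| Ax11 a b : mbCiw_axiom (Imp (Circ a) (Imp a (Imp (Neg a) b)))
| Ax12 a : mbCiw_axiom (Or (Circ a) (And a (Neg a))).

Definition possibilistic_axiom (R : realType) (V : Type)
    (Phi : pformula R V) : Prop :=
  mbCiw_axiom Phi.1 /\ Phi.2%:num = 1.

Definition GMP (R : realType) (V : Type) (P Q C : pformula R V) : Prop :=
  Q.1 = Imp P.1 C.1 /\ C.2%:num = Num.min P.2%:num Q.2%:num.

Definition rule_S (R : realType) (V : Type) (P C : pformula R V) : Prop :=
  C.1 = P.1 /\ C.2%:num <= P.2%:num.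

Definition is_derivation (R : realType) (V : Type) (F : set (pformula R V))
    (Phi : pformula R V) (n : nat) (D : 'I_n.+1 -> pformula R V) : Prop :=
  D ord_max = Phi /\
  forall i : 'I_n.+1,
    [\/ possibilistic_axiom (D i),
        F (D i),
        exists j k : 'I_n.+1, [/\ (j < i)%N, (k < i)%N & GMP (D j) (D k) (D i)]
      | exists j : 'I_n.+1, (j < i)%N /\ rule_S (D j) (D i)].

Definition derives (R : realType) (V : Type) (F : set (pformula R V))
    (Phi : pformula R V) : Prop :=
  exists (n : nat) (D : 'I_n.+1 -> pformula R V), is_derivation F Phi D.

(* Main.v *)
Require Import Defs.
From mathcomp Require Import all_boot all_order all_algebra.
From mathcomp Require Import classical_sets reals interval_inference.

(** A distribution satisfies [(phi; x)] exactly when every valuation falsifying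
    [phi] has possibility at most [1 - x] (lemma [satisfiesP]): the infimum
    defining the necessity measure is at least [x] iff each of its terms is.
    In this form soundness no longer mentions infima and is checked one
    valuation at a time.  Axioms have no falsifying valuation
    ([mbCiw_axiom_valid]).  For modus ponens, a valuation falsifying the
    conclusion falsifies one of the two premises, and the bound that this
    premise puts on its possibility is at least as strong as the one required
    with the minimum of the weights ([GMP_sound]).  Lowering a weight only
    relaxes the bound ([rule_S_sound]).  Strong induction on the position in
    a derivation concludes. *)

Import Order.TTheory GRing.Theory Num.Theory.

Local Open Scope classical_set_scope.
Local Open Scope ring_scope.

Section Valuation.
Variables (V : Type) (v : Val V).
Implicit Types a b : formula V.

Lemma val_andE a b : v (And a b) = v a && v b.
Proof. by apply/idP/andP => /(val_and (val_funP v)). Qed.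

Lemma val_orE a b : v (Or a b) = v a || v b.
Proof. by apply/idP/orP => /(val_or (val_funP v)). Qed.

Lemma val_impE a b : v (Imp a b) = (v a ==> v b).
Proof.
apply/idP/implyP => [/(val_imp (val_funP v))[->|->] //|ab].
by apply/(val_imp (val_funP v)); case: (v a) ab => [/(_ isT)|]; [right|left].
Qed.

Lemma val_circE a : v (Circ a) = ~~ (v a && v (Neg a)).
Proof.
rewrite negb_and; apply/idP/orP.
  by case/(val_circ (val_funP v)) => ->; [left|right].
by move=> H; apply/(val_circ (val_funP v)); case: H => /negbTE; [left|right].
Qed.

Lemma val_excluded_middle a : v a || v (Neg a).
Proof.
by case E: (v (Neg a)); rewrite ?orbT // (val_neg (val_funP v) E).
Qed.

(** Negation is not truth-functional, so the value of [Neg a] counts as a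
    further Boolean variable.  Every schema but one is then a tautology; the
    exception, excluded middle, is the only constraint linking [Neg a] to
    [a]. *)
Lemma mbCiw_axiom_valid chi : mbCiw_axiom chi -> v chi.
Proof.
case=> [a b|a b c|a b|a b|a b|a b|a b|a b c|a b|a|a b|a];
  rewrite ?(val_impE, val_orE, val_andE, val_circE).
1-9: by case: (v a); case: (v b); try case: (v c).
- exact: val_excluded_middle.
- by case: (v a); case: (v (Neg a)).
- exact: orNb.
Qed.

End Valuation.

Section Satisfaction.
Context {R : realType} {V : Type}.
Variable pi : possibility_distribution R V.
Implicit Types P Q C Phi : pformula R V.

Lemma satisfiesP Phi :
  satisfies pi Phi <->
  forall w : Val V, w Phi.1 = false -> Phi.2%:num <= 1 - (pi w)%:num.
Proof.
rewrite /satisfies /necessity /inf01; set A := [set _ | _ in _].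
split=> [xN w wF|xA].
  have Aw : A (1 - (pi w)%:num) by exists w.
  move: xN; case: eqP => [A0|_ xN]; first by move: Aw; rewrite A0.
  apply: le_trans xN _; apply: ge_inf => //.
  by exists 0 => _ [u _ <-]; rewrite subr_ge0.
(* Without falsifying valuations the infimum is 1, and weights are at most 1. *)
case: eqP => [_|/eqP/set0P A0]; first by [].
by apply: lb_le_inf => // _ [w wF <-]; apply: xA.
Qed.

Lemma possibilistic_axiom_sound Phi :
  possibilistic_axiom Phi -> satisfies pi Phi.
Proof.
by case=> ax _; apply/satisfiesP => w; rewrite (mbCiw_axiom_valid _ _ _ ax).
Qed.

Lemma GMP_sound P Q C :
  GMP P Q C -> satisfies pi P -> satisfies pi Q -> satisfies pi C.
Proof.
case=> QE CE /satisfiesP satP /satisfiesP satQ; apply/satisfiesP => w wC.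
rewrite CE ge_min; case wP: (w P.1); last by rewrite satP.
by rewrite satQ ?orbT // QE val_impE wP wC.
Qed.

Lemma rule_S_sound P C : rule_S P C -> satisfies pi P -> satisfies pi C.
Proof.
by rewrite /satisfies => -[-> le_CP]; apply: le_trans.
Qed.

End Satisfaction.

Theorem theorem5p2 (R : realType) (V : Type) (hV : denumerable V)
    (F : set (pformula R V)) (gamma : formula V) (y : {itv R & `]0, 1]}) :
  derives F (gamma, y) -> entails F (gamma, y).
Proof.
case=> n [D [<- D_step]] pi piF.
suff sat m (i : 'I_n.+1) : nat_of_ord i = m -> satisfies pi (D i) by exact: sat.
elim/ltn_ind: m i => m IH i im; rewrite -{m}im in IH.
case: (D_step i) => [ax|Fi|[j [k [ji ki gmp]]]|[j [ji rS]]].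
- exact: possibilistic_axiom_sound.
- exact: piF.
- exact: GMP_sound gmp (IH _ ji _ erefl) (IH _ ki _ erefl).
- exact: rule_S_sound rS (IH _ ji _ erefl).
Qed.
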